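(* Let $(D,X)$ be a Dyer system. Then $(D,X)$ has Property $\mathcal D$, that is: (a) for every syllabic word $w\in S(X)^*$, $w$ is reduced if and only if $w$ is M-reduced; and (b) for all reduced syllabic words $w,w'\in S(X)^*$ with $\overline{w}=\overline{w'}$, one can go from $w$ to $w'$ through a finite sequence of elementary M-operations of type II.
   Context: Dyer systems. Let $\Gamma$ be a simplicial graph (possibly infinite; no loops or multiple edges) with vertex set $V(\Gamma)$ and edge set $E(\Gamma)$, with maps $m:E(\Gamma)\to\mathbb N_{\ge2}$ and $f:V(\Gamma)\to\mathbb N_{\ge2}\cup\{\infty\}$ such that for each edge $e=\{u,v\}$, if $m(e)\neq2$ then $f(u)=f(v)=2$. The Dyer group $D=D(\Gamma,m,f)$ is the group with generators $x_v$ ($v\in V(\Gamma)$) and relations $x_v^{f(v)}=1$ for all $v$ with $f(v)\ne\infty$, and $\overline{[x_u,x_v]}_{m(e)}=\overline{[x_v,x_u]}_{m(e)}$ for all $e=\{u,v\}\in E(\Gamma)$. The pair $(D,X)$ with $X=\{x_v\mid v\in V(\Gamma)\}$ is called a Dyer system (it is known that $v\mapsto x_v$ is injective). Notation. A marked group is a pair $(G,X)$ with $G$ a group and $X\subset G$ a generating set. $o(g)$ is the order of $g$; $\mathbb Z_{o(g)}=\mathbb Z/o(g)\mathbb Z$ if $o(g)$ is finite and $\mathbb Z_{o(g)}=\mathbb Z$ otherwise. The set of syllables is $S(X)=\{x^a\mid x\in X,\ a\in\mathbb Z_{o(x)}\setminus\{0\}\}$. $S(X)^*$ is the free monoid on $S(X)$;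 its elements are called syllabic words, written as finite sequences, with concatenation written $w\cdot w'$. For $w=(s_1,\dots,s_\ell)$, $\overline w=s_1\cdots s_\ell\in G$. The syllabic length $\lg_{S(X)}(g)$ is the shortest length of a syllabic word $w$ with $\overline w=g$; a word $w$ of length $\ell$ is reduced if $\ell=\lg_{S(X)}(\overline w)$. For $m\ge2$, $[a,b]_m$ is the alternating word $(a,b,a,\dots)$ of length $m$, and $\overline{[a,b]}_m$ is the alternating product $aba\cdots$ with $m$ factors. M-operations. Type I: if $w=w_1\cdot(s,t)\cdot w_2$ with $s,t\in S(X)$ and $st\in S(X)\cup\{1\}$, replace $w$ by $w_1\cdot(st)\cdot w_2$ if $st\ne1$, and by $w_1\cdot w_2$ if $st=1$. Type II: if $w=w_1\cdot[s,t]_m\cdot w_2$ with $s,t\in S(X)$, $m\ge2$, $\overline{[s,t]}_m=\overline{[t,s]}_m$ and $\lg_{S(X)}(\overline{[s,t]}_m)=m$, replace $w$ by $w_1\cdot[t,s]_m\cdot w_2$. A word is M-reduced if its length cannot be shortened by any finite sequence of elementary M-operations. *)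

(* Defs.v *)
From HB Require Import structures.
From Stdlib Require Import Relation_Operators.
From mathcomp Require Import all_boot all_order all_algebra.
From mathcomp Require Import boolp classical_sets.

Set Implicit Arguments.
Unset Strict Implicit.
Unset Printing Implicit Defensive.

Local Open Scope group_scope.
Local Open Scope quotient_scope.

Fixpoint alternating (T : Type) (m : nat) (a b : T) : seq T :=
  if m is m'.+1 then a :: alternating m' b a else [::].

(* The least element of A, and 0 if A is empty. *)
Definition least (A : set nat) : nat :=
  xget 0 [set n | A n /\ forall k, A k -> n <= k]%classic.

Lemma leastP (A : set nat) n :
  A n -> A (least A) /\ forall k, A k -> least A <= k.
Proof.
move=> An; rewrite /least.
apply: (@xgetPex _ 0 [set n | A n /\ forall k, A k -> n <= k]%classic).
have exA : exists k, `[< A k >] by exists n; apply/asboolP.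
case: (ex_minnP exA) => k /asboolP Ak kmin; exists k; split=> // j Aj.
by apply: kmin; apply/asboolP.
Qed.

Lemma least_eq0 (A : set nat) : (forall n, ~ A n) -> least A = 0.
Proof. by move=> A0; apply: xgetPN => n [/A0]. Qed.

(* The group presented by the generators V and the equations l = r, for
   R l r.  A letter (v, false) stands for the generator v and (v, true) for
   its formal inverse. *)
Section Presentation.
Variable V : Type.

Definition gword : Type := seq (V * bool).
HB.instance Definition _ := gen_eqMixin gword.
HB.instance Definition _ := gen_choiceMixin gword.

Variable R : gword -> gword -> Prop.

Inductive pres_eq : gword -> gword -> Prop :=
| pres_refl u : pres_eq u u
| pres_sym u v : pres_eq u v -> pres_eq v u
| pres_trans u v w : pres_eq u v -> pres_eq v w -> pres_eq u w
| pres_cancel u w v b :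
    pres_eq (u ++ [:: (v, b); (v, ~~ b)] ++ w) (u ++ w)
| pres_rel u w l r : R l r -> pres_eq (u ++ l ++ w) (u ++ r ++ w).

Lemma pres_eq_ctx u1 u2 v w :
  pres_eq v w -> pres_eq (u1 ++ v ++ u2) (u1 ++ w ++ u2).
Proof.
elim=> {v w}.
- by move=> u; apply: pres_refl.
- by move=> u v _; apply: pres_sym.
- by move=> u v w _ uv _; apply: pres_trans.
- by move=> u w v b; have := pres_cancel (u1 ++ u) (w ++ u2) v b; rewrite -!catA.
- move=> u w l r Rlr; have := pres_rel (u1 ++ u) (w ++ u2) Rlr.
  by rewrite -!catA.
Qed.

Lemma pres_eq_cat u v u' v' :
  pres_eq u u' -> pres_eq v v' -> pres_eq (u ++ v) (u' ++ v').
Proof.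
move=> uu' vv'; apply: (@pres_trans _ (u' ++ v)).
  exact: (pres_eq_ctx [::] v uu').
by have := pres_eq_ctx u' [::] vv'; rewrite !cats0.
Qed.

Definition gword_inv (w : gword) : gword :=
  rev [seq (a.1, ~~ a.2) | a <- w].

Lemma gword_inv_cat u v : gword_inv (u ++ v) = gword_inv v ++ gword_inv u.
Proof. by rewrite /gword_inv map_cat rev_cat. Qed.

Lemma gword_invK : involutive gword_inv.
Proof.
move=> w; rewrite /gword_inv map_rev revK -map_comp -[RHS]map_id.
by apply: eq_map => -[v b] /=; rewrite negbK.
Qed.

Lemma pres_eq_invl w : pres_eq (gword_inv w ++ w) [::].
Proof.
elim: w => [|[v b] w IHw]; first exact: pres_refl.
rewrite -cat1s gword_inv_cat -catA.
apply: pres_trans IHw.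
by have := pres_cancel (gword_inv w) w v (~~ b); rewrite negbK.
Qed.

Lemma pres_eq_inv u v : pres_eq u v -> pres_eq (gword_inv u) (gword_inv v).
Proof.
move=> uv.
have vu : pres_eq (gword_inv u ++ v) [::].
  apply: pres_trans (pres_eq_invl u); apply: pres_eq_cat (pres_refl _) _.
  exact: pres_sym.
have vV : pres_eq (v ++ gword_inv v) [::].
  by have := pres_eq_invl (gword_inv v); rewrite gword_invK.
have := pres_eq_cat vu (pres_refl (gword_inv v)).
rewrite -catA; apply: pres_trans; apply: pres_sym.
by have := pres_eq_cat (pres_refl (gword_inv u)) vV; rewrite cats0.
Qed.

Definition pres_eqb (u v : gword) : bool := `[< pres_eq u v >].

Fact pres_eqb_refl : reflexive pres_eqb.
Proof. by move=> u; apply/asboolP/pres_refl. Qed.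

Fact pres_eqb_sym : symmetric pres_eqb.
Proof. by move=> u v; apply/asboolP/asboolP; apply: pres_sym. Qed.

Fact pres_eqb_trans : transitive pres_eqb.
Proof.
by move=> v u w /asboolP uv /asboolP vw; apply/asboolP/(pres_trans uv vw).
Qed.

Canonical pres_equiv :=
  EquivRel pres_eqb pres_eqb_refl pres_eqb_sym pres_eqb_trans.

Definition pres_group : Type := {eq_quot pres_equiv}.
HB.instance Definition _ := Choice.on pres_group.

Definition pres_class (w : gword) : pres_group := \pi_{eq_quot pres_equiv} w.
Definition pres_repr (x : pres_group) : gword :=
  repr (x : {eq_quot pres_equiv}).

Lemma pres_classP u v : pres_class u = pres_class v <-> pres_eq u v.
Proof.
split; first by move/(@eqmodP _ pres_equiv) => /asboolP.
by move=> uv; apply/(@eqmodP _ pres_equiv)/asboolP.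
Qed.

Lemma pres_reprK x : pres_class (pres_repr x) = x.
Proof. exact: reprK. Qed.

Lemma pres_repr_class w : pres_eq (pres_repr (pres_class w)) w.
Proof. by apply/pres_classP/pres_reprK. Qed.

Definition pres_one : pres_group := pres_class [::].
Definition pres_mul (x y : pres_group) : pres_group :=
  pres_class (pres_repr x ++ pres_repr y).
Definition pres_inv (x : pres_group) : pres_group :=
  pres_class (gword_inv (pres_repr x)).

Lemma pres_mulE u v :
  pres_mul (pres_class u) (pres_class v) = pres_class (u ++ v).
Proof. by apply/pres_classP/pres_eq_cat; apply: pres_repr_class. Qed.

Lemma pres_invE u : pres_inv (pres_class u) = pres_class (gword_inv u).
Proof. by apply/pres_classP/pres_eq_inv/pres_repr_class. Qed.

Fact pres_mulA : associative pres_mul.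
Proof.
move=> x y z; rewrite -[x]pres_reprK -[y]pres_reprK -[z]pres_reprK.
by rewrite !pres_mulE catA.
Qed.

Fact pres_mul1 : left_id pres_one pres_mul.
Proof. by move=> x; rewrite -[x]pres_reprK pres_mulE. Qed.

Fact pres_mulr1 : right_id pres_one pres_mul.
Proof. by move=> x; rewrite -[x]pres_reprK pres_mulE cats0. Qed.

Fact pres_mulV : left_inverse pres_one pres_inv pres_mul.
Proof.
move=> x; rewrite -[x]pres_reprK pres_invE pres_mulE.
exact/pres_classP/pres_eq_invl.
Qed.

Fact pres_mulrV : right_inverse pres_one pres_inv pres_mul.
Proof.
move=> x; rewrite -[x]pres_reprK pres_invE pres_mulE.
apply/pres_classP; rewrite -{1}(gword_invK (pres_repr x)).
exact: pres_eq_invl.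
Qed.

HB.instance Definition _ := isGroup.Build pres_group
  pres_mulA pres_mul1 pres_mulr1 pres_mulV pres_mulrV.

Definition pres_gen (v : V) : pres_group := pres_class [:: (v, false)].

Lemma pres_class_cat u v :
  pres_class (u ++ v) = pres_class u * pres_class v.
Proof. by rewrite -pres_mulE. Qed.

Definition gword_eval (H : groupType) (h : V -> H) (w : gword) : H :=
  \prod_(a <- w) (if a.2 then (h a.1)^-1 else h a.1).

Lemma pres_classE w : pres_class w = gword_eval pres_gen w.
Proof.
elim: w => [|[v b] w IHw]; first by rewrite /gword_eval big_nil.
rewrite -cat1s pres_class_cat IHw /gword_eval big_cons /=; congr (_ * _).
by case: b => //; rewrite -[RHS]/(pres_inv _) pres_invE.
Qed.

Lemma gword_eval_pres_eq (H : groupType) (h : V -> H) :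
    (forall l r, R l r -> gword_eval h l = gword_eval h r) ->
  forall u v, pres_eq u v -> gword_eval h u = gword_eval h v.
Proof.
rewrite /gword_eval => hR u v; elim=> {u v} //.
- by move=> u v w _ -> _ ->.
- move=> u w v b; rewrite !big_cat !big_cons big_nil /=.
  by case: b => /=; rewrite mulg1 ?mulVg ?mulgV mul1g.
- by move=> u w l r /hR; rewrite !big_cat /= => ->.
Qed.

Lemma pres_universal (H : groupType) (h : V -> H) :
    (forall l r, R l r -> gword_eval h l = gword_eval h r) ->
  exists! phi : pres_group -> H,
    {morph phi : x y / x * y} /\ forall v, phi (pres_gen v) = h v.
Proof.
move=> hR; pose phi x := gword_eval h (pres_repr x).
have phiE w : phi (pres_class w) = gword_eval h w.
  exact/(gword_eval_pres_eq hR)/pres_repr_class.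
exists phi; split; first split.
- move=> x y; rewrite -[x]pres_reprK -[y]pres_reprK -pres_class_cat !phiE.
  by rewrite /gword_eval big_cat.
- by move=> v; rewrite phiE /gword_eval big_seq1.
move=> psi [psiM psiv]; apply: funext => x; rewrite -[x]pres_reprK phiE.
have psi1 : psi 1 = 1 by apply: (mulgI (psi 1)); rewrite -psiM !mulg1.
have psiV y : psi y^-1 = (psi y)^-1.
  by apply: (mulgI (psi y)); rewrite -psiM !mulgV.
rewrite pres_classE /gword_eval (big_morph psi psiM psi1).
by apply: eq_bigr => -[v []] _ /=; rewrite ?psiV psiv.
Qed.

End Presentation.

(* A Dyer graph: dg_f v = None encodes f(v) = infinity, and dg_m u v is
   only meaningful when u and v are adjacent. *)
Record dyer_graph (V : Type) := DyerGraph {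
  dg_adj : V -> V -> Prop;
  dg_m : V -> V -> nat;
  dg_f : V -> option nat;
  dg_adj_irr : forall v, ~ dg_adj v v;
  dg_adj_sym : forall u v, dg_adj u v -> dg_adj v u;
  dg_m_sym : forall u v, dg_adj u v -> dg_m u v = dg_m v u;
  dg_m_ge2 : forall u v, dg_adj u v -> 2 <= dg_m u v;
  dg_f_ge2 : forall v n, dg_f v = Some n -> 2 <= n;
  dg_m_neq2 : forall u v, dg_adj u v -> dg_m u v <> 2 ->
    dg_f u = Some 2 /\ dg_f v = Some 2
}.

Inductive dyer_rel (V : Type) (Gamma : dyer_graph V) :
    gword V -> gword V -> Prop :=
| dyer_rel_order v n :
    dg_f Gamma v = Some n -> dyer_rel Gamma (nseq n (v, false)) [::]
| dyer_rel_braid u v :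
    dg_adj Gamma u v ->
    dyer_rel Gamma (alternating (dg_m Gamma u v) (u, false) (v, false))
                   (alternating (dg_m Gamma u v) (v, false) (u, false)).

Definition dyer_group (V : Type) (Gamma : dyer_graph V) : groupType :=
  pres_group (dyer_rel Gamma).

Definition dyer_gen (V : Type) (Gamma : dyer_graph V) (v : V) :
  dyer_group Gamma := pres_gen (dyer_rel Gamma) v.

Definition zexpg (G : groupType) (g : G) (a : int) : G :=
  match a with Posz n => g ^+ n | Negz n => g ^- n.+1 end.

Definition generates (G : groupType) (X : set G) : Prop :=
  forall H : set G, H 1 -> (forall g h, H g -> H h -> H (g * h)) ->
    (forall g, H g -> H g^-1) -> (forall x, X x -> H x) -> forall g, H g.

Record marked_group := MarkedGroup {
  mg_sort :> groupType;
  mg_gens : set mg_sort;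
  mg_generates : generates mg_gens
}.

Section MarkedGroup.
Variable M : marked_group.
Implicit Types (g s t : M) (w : seq M).

(* The order of g, with the value 0 when g has infinite order, so that
   Z_o(g) is Z / (gorder g) Z in both cases. *)
Definition gorder g : nat := least [set n | 0 < n /\ g ^+ n = 1]%classic.

Definition syllable s : Prop :=
  exists x, mg_gens x /\
    exists a : int, ~~ (Posz (gorder x) %| a)%Z /\ s = zexpg x a.

Definition syllabic w : Prop := forall s, s \in w -> syllable s.

Definition wprod w : M := \prod_(s <- w) s.

Definition syl_length g : nat :=
  least [set l | exists w, [/\ syllabic w, wprod w = g & size w = l]]%classic.

Definition reduced w : Prop := size w = syl_length (wprod w).

Inductive M_op1 : seq M -> seq M -> Prop :=
| M_op1_merge w1 w2 s t :
    syllable s -> syllable t -> syllable (s * t) -> s * t <> 1 ->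
    M_op1 (w1 ++ [:: s; t] ++ w2) (w1 ++ [:: s * t] ++ w2)
| M_op1_cancel w1 w2 s t :
    syllable s -> syllable t -> s * t = 1 ->
    M_op1 (w1 ++ [:: s; t] ++ w2) (w1 ++ w2).

Inductive M_op2 : seq M -> seq M -> Prop :=
| M_op2_swap w1 w2 s t k :
    syllable s -> syllable t -> 2 <= k ->
    wprod (alternating k s t) = wprod (alternating k t s) ->
    syl_length (wprod (alternating k s t)) = k ->
    M_op2 (w1 ++ alternating k s t ++ w2) (w1 ++ alternating k t s ++ w2).

Definition M_op w w' : Prop := M_op1 w w' \/ M_op2 w w'.

Definition M_reduced w : Prop :=
  forall w', clos_refl_trans _ M_op w w' -> size w <= size w'.

End MarkedGroup.

Definition property_D (M : marked_group) : Prop :=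
  (forall w : seq M, syllabic w -> (reduced w <-> M_reduced w)) /\
  (forall w w' : seq M,
     syllabic w -> syllabic w' -> reduced w -> reduced w' ->
     wprod w = wprod w' -> clos_refl_trans _ (@M_op2 M) w w').

Definition dyer_gens (V : Type) (Gamma : dyer_graph V) :
  set (dyer_group Gamma) := range (@dyer_gen V Gamma).

Lemma dyer_generates (V : Type) (Gamma : dyer_graph V) :
  generates (@dyer_gens V Gamma).
Proof.
move=> H H1 HM HV HX g; rewrite -[g]pres_reprK pres_classE /gword_eval.
elim: (pres_repr _) => [|[v b] w IHw]; first by rewrite big_nil.
have Hv : H (dyer_gen Gamma v) by apply: HX; exists v.
by rewrite big_cons; apply: HM IHw => /=; case: b => //; apply: HV.
Qed.

Definition dyer_system (V : Type) (Gamma : dyer_graph V) : marked_group :=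
  MarkedGroup (@dyer_generates V Gamma).

(* Main.v *)
(* The group D carries a derivation N sending each generator x to the basis
   vector e_x, with values in the sum, over the conjugates t of generators, of
   Z/o(t): the Dyer relations say exactly that N is compatible with them.  A
   generator x is then a left descent of g if and only if N(g) is nonzero at x,
   which yields an exchange property for reduced words.  If two distinct
   generators x and y are descents of g, a reduced word for g with a maximal
   prefix over {x, y} has a prefix z which itself has both descents; exchanging
   at either end shows that the two alternating words for z are shifts of each
   other, hence of the form [x^a, y^b]_k and [y^b, x^a]_k.  Property D follows
   from this by induction, as in Tits' solution of the word problem. *)
Require Import Defs.
From Stdlib Require Import Relation_Operators.
From Stdlib Require List.
From mathcomp Require Import all_boot all_order all_algebra.
From mathcomp Require Import boolp classical_sets.

Set Implicit Arguments.
Unset Strict Implicit.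
Unset Printing Implicit Defensive.

Import GRing.Theory.
Local Open Scope group_scope.

(** * Integer powers and conjugation *)

Section IntegerPowers.
Variable G : groupType.
Implicit Types (g h : G) (a b : int).

Lemma zexpgS g a : zexpg g (a + 1)%R = zexpg g a * g.
Proof.
case: a => [n | [|n]].
  have -> : (Posz n + 1)%R = Posz n.+1 by rewrite -addn1 PoszD.
  by rewrite /= expgSr.
  by rewrite /= expg1 mulVg.
have -> : (Negz n.+1 + 1)%R = Negz n by rewrite !NegzE -[n.+2]addn1 PoszD opprD addrNK.
by rewrite /= [in RHS]expgS invgM mulgVK.
Qed.

Lemma zexpgD g a b : zexpg g (a + b)%R = zexpg g a * zexpg g b.
Proof.
elim/int_rect: b => [|n IH|n IH]; first by rewrite addr0 mulg1.
  by rewrite -addn1 PoszD addrA !zexpgS IH mulgA.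
apply: (mulIg g); rewrite -mulgA -!zexpgS -addrA.
by rewrite -addn1 PoszD opprD addrNK.
Qed.

Lemma zexpgN g a : zexpg g (- a)%R = (zexpg g a)^-1.
Proof. by apply/esym/mulg1_eq; rewrite -zexpgD subrr. Qed.

Lemma zexpgJ g h a : zexpg g a ^ h = zexpg (g ^ h) a.
Proof. by case: a => n /=; rewrite ?conjVg conjXg. Qed.

Lemma conjg_zexp g a : g ^ zexpg g a = g.
Proof.
have ga : zexpg g a * g = g * zexpg g a by rewrite -zexpgS addrC zexpgD.
by rewrite conjgE -ga mulKg.
Qed.

Lemma mulg_expgC g h n : g * (h * g) ^+ n = (g * h) ^+ n * g.
Proof.
elim: n => [|n IH]; first by rewrite mulg1 mul1g.
by rewrite expgSr mulgA IH expgSr -!mulgA.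
Qed.

Lemma conjg_eqC g h k : (g ^ k == h) = (g == h ^ k^-1).
Proof. by rewrite -(inj_eq (@conjg_inj _ k)) conjgKV. Qed.

End IntegerPowers.

(** * Orders of elements as divisibility *)

Section Orders.
Variable M : marked_group.
Implicit Types (g h : M) (a b : int).

(** Coding infinite order by 0 makes this uniform, since 0 divides only 0. *)
Lemma gorder_dvdn g n : g ^+ n = 1 <-> gorder g %| n.
Proof.
have [->|n_gt0] := posnP n; first by rewrite dvdn0.
have [[k [k_gt0 gk]]|ord0] := pselect (exists k, 0 < k /\ g ^+ k = 1); last first.
  have -> : gorder g = 0 by apply: least_eq0 => k /= Hk; apply: ord0; exists k.
  rewrite dvd0n eqn0Ngt n_gt0; split=> // gn.
  by case: ord0; exists n.
have [/= [d_gt0 gd] dmin] :=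
  leastP (A := [set n | 0 < n /\ g ^+ n = 1]%classic) (conj k_gt0 gk).
rewrite -/(gorder g) in d_gt0 gd dmin.
have gmod : g ^+ n = g ^+ (n %% gorder g).
  by rewrite {1}(divn_eq n (gorder g)) expgnDr mulnC expgnA gd expg1n mul1g.
split=> [gn|/dvdnP[q ->]]; last by rewrite mulnC expgnA gd expg1n.
rewrite /dvdn eqn0Ngt; apply/negP => r_gt0.
have /dmin : 0 < n %% gorder g /\ g ^+ (n %% gorder g) = 1 by rewrite -gmod.
by rewrite leqNgt ltn_mod d_gt0.
Qed.

Lemma gorder_dvdz g a : zexpg g a = 1 <-> (gorder g %| a)%Z.
Proof.
rewrite dvdzE /=; case: a => n /=; rewrite -gorder_dvdn //.
by split=> [/eqP|->]; [rewrite invg_eq1 => /eqP|rewrite invg1].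
Qed.

Lemma eq_zexpg g a b : (a = b %[mod gorder g])%Z <-> zexpg g a = zexpg g b.
Proof.
rewrite (rwP eqP) eqz_mod_dvd -gorder_dvdz zexpgD zexpgN.
by split=> [/divg1_eq | ->]; rewrite ?mulgV.
Qed.

Lemma gorderJ g h : gorder (g ^ h) = gorder g.
Proof.
have dvdJ (x y : M) : gorder (x ^ y) %| gorder x.
  by apply: (gorder_dvdn _ _).1; rewrite -conjXg (gorder_dvdn _ _).2 ?conj1g.
by apply/eqP; rewrite eqn_dvd dvdJ -{1}(conjgK h g) dvdJ.
Qed.

End Orders.

(** * Alternating words *)

Section Alternating.
Variable T : Type.
Implicit Types (s t : T).

Lemma size_alternating k s t : size (alternating k s t) = k.
Proof. by elim: k s t => //= k IH s t; rewrite IH. Qed.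

Lemma map_alternating (T' : Type) (f : T -> T') k s t :
  map f (alternating k s t) = alternating k (f s) (f t).
Proof. by elim: k s t => //= k IH s t; rewrite IH. Qed.

Lemma all_alternating (P : T -> Prop) k s t : P s -> P t ->
  List.Forall P (alternating k s t).
Proof.
by elim: k s t => [|k IH] s t Ps Pt /=; constructor => //; apply: IH.
Qed.

(** Up to its last letter, the tail of each word is the beginning of the other, so a prefix of
    length n + 1 of one is its head followed by the prefix of length n of the other. *)
Lemma mutual_shift_alternating s t u u' p p' :
    s :: u = rcons u' p' -> t :: u' = rcons u p ->
  s :: u = alternating (size u).+1 s t /\ t :: u' = alternating (size u).+1 t s.
Proof.
move=> su tu.
have sz : size u' = size u by move/(congr1 size): su; rewrite size_rcons => -[].
have H n : n <= (size u).+1 ->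
    take n (s :: u) = alternating n s t /\ take n (t :: u') = alternating n t s.
  elim: n => [|n IH] // le_n; have [IHs IHt] := IH (ltnW le_n).
  rewrite /= -IHs -IHt su tu -!cats1 !takel_cat ?sz //.
have [] := H _ (leqnn _).
by rewrite -{1}[(size u).+1]/(size (s :: u)) take_size -{2}sz
   -[(size u').+1]/(size (t :: u')) take_size.
Qed.

End Alternating.

(** * Property D from a derivation *)

Section Derivation.
(* [N g t] is the coordinate at [t]; it only matters modulo [gorder t], which is
   equality of integers when [t] has infinite order. *)
Variables (M : marked_group) (N : M -> M -> int).
Hypothesis ND : forall g h t,
  (N (g * h)%g t = N g t + N h (t ^ g)%g %[mod gorder t])%Z.
Hypothesis Ngen : forall x t, mg_gens x -> (N x t = (t == x) %[mod gorder t])%Z.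

Implicit Types (g h t x y : M) (a b : int) (p q : M * int) (u v w : seq (M * int)).

Let nz g t : bool := ~~ (gorder t %| N g t)%Z.

(** * The derivation on powers and words; exchange *)

Lemma N1 t : (N 1 t = 0 %[mod gorder t])%Z.
Proof.
have /eqP := ND 1 1 t; rewrite mulg1 conjg1 -{1}[N 1 t]addr0 eqz_modDl.
by move/eqP.
Qed.

Lemma N_mul g h t a b : (N g t = a %[mod gorder t])%Z ->
  (N h (t ^ g) = b %[mod gorder t])%Z -> (N (g * h)%g t = a + b %[mod gorder t])%Z.
Proof. by move=> Ng Nh; rewrite ND -modzDm Ng Nh modzDm. Qed.

(** Conjugation by a power of x fixes x, so each further factor x contributes at t = x and nowhere
    else. *)
Lemma N_zexpg x a t : mg_gens x ->
  (N (zexpg x a) t = a * (t == x) %[mod gorder t])%Z.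
Proof.
move=> Xx.
have NS b : (N (zexpg x (b + 1)%R) t = N (zexpg x b) t + (t == x) %[mod gorder t])%Z.
  rewrite zexpgS; apply: N_mul => //.
  by rewrite -(gorderJ t (zexpg x b)) Ngen // conjg_eqC -zexpgN conjg_zexp.
elim/int_rect: a => [|n IH|n IH]; first by rewrite mul0r N1.
  by rewrite -addn1 PoszD NS -modzDml IH modzDml mulrDl mul1r.
apply/eqP; rewrite -(eqz_modDr (t == x)%:Z) -NS; apply/eqP.
by rewrite -addn1 PoszD opprD addrNK IH mulrBl mul1r addrNK.
Qed.

Lemma nz_mul g h t : nz (g * h) t -> nz g t || nz h (t ^ g).
Proof.
rewrite -negb_and; apply: contra => /andP[/dvdz_mod0P g0 /dvdz_mod0P h0].
rewrite gorderJ in h0.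
by apply/dvdz_mod0P; rewrite (N_mul (a := 0) (b := 0)) ?mod0z.
Qed.

(** Words are made of pairs (x, a) so that the generator and the exponent can be read off; pairs
    with exponents congruent modulo the order of x give the same syllable. *)
Definition letter_val p : M := zexpg p.1 p.2.
Definition word_val w : M := wprod (map letter_val w).
Definition good_letter p : Prop := mg_gens p.1 /\ ~~ (gorder p.1 %| p.2)%Z.
Definition good_word w : Prop := List.Forall good_letter w.

Lemma word_val_cons p w : word_val (p :: w) = letter_val p * word_val w.
Proof. by rewrite /word_val /wprod big_cons. Qed.

Lemma word_val_cat u v : word_val (u ++ v) = word_val u * word_val v.
Proof. by rewrite /word_val /wprod map_cat big_cat. Qed.

Lemma word_val_nil : word_val [::] = 1.
Proof. exact: big_nil. Qed.

Lemma good_cons p w : good_word (p :: w) <-> good_letter p /\ good_word w.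
Proof. exact: List.Forall_cons_iff. Qed.

Lemma good_cat u v : good_word (u ++ v) <-> good_word u /\ good_word v.
Proof. exact: List.Forall_app. Qed.

(** The coordinate at t is the sum of the contributions of the letters, and a letter after the
    prefix u contributes only if its generator is t ^ u. *)
Lemma nz_split w t : good_word w -> nz (word_val w) t ->
  exists u p v, w = u ++ p :: v /\ t ^ word_val u = p.1.
Proof.
elim: w t => [|p w IH] t.
  by move=> _ /negP[]; rewrite word_val_nil; apply/dvdz_mod0P; rewrite N1 mod0z.
move=> /good_cons[[Xp _] gw]; rewrite word_val_cons => /nz_mul/orP[nzp|].
  exists [::], p, w; split=> //; rewrite word_val_nil conjg1.
  apply/eqP; apply: contraNT nzp => /negPf tp.
  by apply/dvdz_mod0P; rewrite N_zexpg // tp mulr0 mod0z.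
move=> /(IH _ gw)[u [q [v [-> uq]]]]; exists (p :: u), q, v; split=> //.
by rewrite word_val_cons conjgM.
Qed.

(** The generator of the letter found is t ^ u, so this letter passes to the left of u as a power of
    t. *)
Lemma exchange w t : good_word w -> nz (word_val w) t ->
  exists u p v, [/\ w = u ++ p :: v, t ^ word_val u = p.1,
    ~~ (gorder t %| p.2)%Z & word_val w = zexpg t p.2 * word_val (u ++ v)].
Proof.
move=> gw /(nz_split gw)[u [p [v [w_eq up]]]]; exists u, p, v.
split=> //.
  by rewrite w_eq in gw; have [_ /good_cons[[_ +] _]] := (good_cat _ _).1 gw;
     rewrite -up gorderJ.
rewrite w_eq !word_val_cat word_val_cons /letter_val -up -zexpgJ conjgE.
by rewrite !mulgA mulgV mul1g.
Qed.

(** * Reduced words and descents *)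

Definition red_word w : Prop :=
  good_word w /\
  forall w', good_word w' -> word_val w' = word_val w -> size w <= size w'.

Lemma red_word_eq w w' : red_word w -> good_word w' ->
  word_val w' = word_val w -> size w' <= size w -> red_word w'.
Proof.
move=> [_ wmin] gw' ww' le_w'; split=> // v gv vw.
by apply: leq_trans le_w' (wmin _ gv _); rewrite vw.
Qed.

Lemma red_word_catr u v : red_word (u ++ v) -> red_word v.
Proof.
move=> [/good_cat[gu gv] vmin]; split=> // v' gv' v'v.
have := vmin (u ++ v') ((good_cat _ _).2 (conj gu gv')).
by rewrite !word_val_cat v'v !size_cat leq_add2l; apply.
Qed.

Lemma red_word_catl u v : red_word (u ++ v) -> red_word u.
Proof.
move=> [/good_cat[gu gv] vmin]; split=> // u' gu' u'u.
have := vmin (u' ++ v) ((good_cat _ _).2 (conj gu' gv)).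
by rewrite !word_val_cat u'u !size_cat leq_add2r; apply.
Qed.

Lemma absorb x a w : mg_gens x -> good_word w ->
  exists w', [/\ good_word w', word_val w' = zexpg x a * word_val w
    & size w' <= (size w).+1].
Proof.
move=> Xx gw; have [xa|xa] := boolP (gorder x %| a)%Z.
  by exists w; rewrite ((gorder_dvdz _ _).2 xa) mul1g.
by exists ((x, a) :: w); split; rewrite ?word_val_cons //; apply/good_cons.
Qed.

(** Otherwise exchange extracts a power of x from w, deleting a letter, and x^a absorbs it: the
    result is shorter than the given word. *)
Lemma red_cons_nz x a w : red_word ((x, a) :: w) -> ~~ nz (word_val w) x.
Proof.
move=> [/good_cons[[/= Xx xa] gw] wmin]; apply/negP => /(exchange gw).
move=> [u [p [v [w_eq _ _ val_w]]]].
have guv : good_word (u ++ v).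
  move: gw; rewrite w_eq => /good_cat[gu /good_cons[_ gv]].
  exact/good_cat.
have [w' [gw' w'_val le_w']] := absorb (a + p.2)%R Xx guv.
have /(wmin _ gw') : word_val w' = word_val ((x, a) :: w).
  by rewrite w'_val word_val_cons val_w zexpgD mulgA.
rewrite leqNgt (leq_ltn_trans le_w') //= w_eq !size_cat /=.
by rewrite addnS.
Qed.

(** The tail contributes nothing at x. Hence the element and the first generator determine the first
    exponent modulo the order. *)
Lemma N_red_cons x a w : red_word ((x, a) :: w) ->
  (N (word_val ((x, a) :: w)) x = a %[mod gorder x])%Z.
Proof.
move=> rw; have [/good_cons[[/= Xx _] _] _] := rw.
rewrite word_val_cons -[a in RHS]addr0; apply: N_mul.
  by rewrite N_zexpg // eqxx mulr1.
rewrite conjg_zexp mod0z; apply/dvdz_mod0P.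
by have := red_cons_nz rw; rewrite negbK.
Qed.

Lemma nz_red_cons x a w : red_word ((x, a) :: w) ->
  nz (word_val ((x, a) :: w)) x.
Proof.
move=> rw; have [/good_cons[[/= _ xa] _] _] := rw.
apply/negP => /dvdz_mod0P; rewrite N_red_cons // => /dvdz_mod0P.
by rewrite (negPf xa).
Qed.

Lemma nz_red_word w x : mg_gens x -> red_word w -> nz (word_val w) x ->
  exists c u p v, [/\ w = u ++ p :: v, x ^ word_val u = p.1,
    red_word ((x, c) :: u ++ v)
    & word_val ((x, c) :: u ++ v) = word_val w].
Proof.
move=> Xx rw nzw; have [gw _] := rw.
have [u [p [v [w_eq up xp val_w]]]] := exchange gw nzw.
exists p.2, u, p, v; split=> //; last by rewrite word_val_cons val_w.
apply: red_word_eq rw _ _ _; last 2 first.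
- by rewrite word_val_cons val_w.
- by rewrite w_eq /= !size_cat addnS.
move: gw; rewrite w_eq => /good_cat[gu /good_cons[_ gv]].
by apply/good_cons; split=> //; apply/good_cat.
Qed.

(** A shorter word v for x^a w has coordinate a at x, so exchange writes w as a power of x times a
    word shorter than w. If that power is trivial, w was not minimal; if not, x is a descent of
    w. *)
Lemma red_cons x a w : good_letter (x, a) -> red_word w ->
  ~~ nz (word_val w) x -> red_word ((x, a) :: w).
Proof.
move=> [/= Xx xa] rw wx; have [gw wmin] := rw.
split=> [|v gv v_val]; first exact/good_cons.
rewrite leqNgt; apply/negP => /=; rewrite ltnS => le_v.
have nzv : nz (word_val v) x.
  apply: contra xa => /dvdz_mod0P vx; apply/dvdz_mod0P; rewrite -vx v_val.
  rewrite word_val_cons -[a in LHS]addr0; apply/esym/N_mul.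
    by rewrite N_zexpg // eqxx mulr1.
  by rewrite conjg_zexp mod0z; apply/dvdz_mod0P; rewrite negbK in wx.
have [u1 [p [u2 [v_eq _ _ val_v]]]] := exchange gv nzv.
have gu : good_word (u1 ++ u2).
  move: gv; rewrite v_eq => /good_cat[gu1 /good_cons[_ gu2]].
  exact/good_cat.
have lt_u : size (u1 ++ u2) < size w.
  by move: le_v; rewrite v_eq !size_cat /= addnS.
have w_val : word_val w = zexpg x (p.2 - a)%R * word_val (u1 ++ u2).
  rewrite addrC zexpgD zexpgN -mulgA -val_v v_val word_val_cons.
  by rewrite mulKg.
have [xpa|xpa] := boolP (gorder x %| (p.2 - a)%R)%Z.
  have := wmin _ gu; rewrite w_val ((gorder_dvdz _ _).2 xpa) mul1g.
  by rewrite leqNgt lt_u => /(_ erefl).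
have rw' : red_word ((x, (p.2 - a)%R) :: u1 ++ u2).
  apply: red_word_eq rw _ _ _ => //; last by rewrite word_val_cons.
  exact/good_cons.
by have := nz_red_cons rw'; rewrite word_val_cons -w_val (negPf wx).
Qed.

Lemma red_adjacent u p q v : red_word (u ++ p :: q :: v) -> p.1 <> q.1.
Proof.
case: p q => [x a] [y b] /red_word_catr rw /= xy; subst y.
move: (red_cons_nz rw) (rw) => /negP + /(@red_word_catr [:: (x, a)]).
by move=> + /nz_red_cons.
Qed.

Lemma red_nil w : red_word w -> word_val w = 1 -> w = [::].
Proof.
move=> [_ wmin] w1; have := wmin [::] (List.Forall_nil _).
by rewrite word_val_nil w1 leqn0 => /(_ erefl)/nilP.
Qed.

(** * Words over two generators and braid forms *)

Let over x y w : bool := all (fun p => (p.1 == x) || (p.1 == y)) w.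

Lemma over_sym x y w : over x y w = over y x w.
Proof. by apply: eq_all => p; rewrite orbC. Qed.

Lemma over_third x y p q r : over x y [:: p; q; r] ->
  p.1 <> q.1 -> q.1 <> r.1 -> p.1 = r.1.
Proof.
by case/and4P=> /orP[]/eqP-> /orP[]/eqP-> /orP[]/eqP->.
Qed.

(** The generators of a reduced word over {x, y} alternate, so the first one determines the others;
    the derivation gives each exponent in turn, after cancelling the previous syllables. *)
Lemma red_over_uniq x y p q w v : red_word (p :: w) -> red_word (q :: v) ->
    over x y (p :: w) -> over x y (q :: v) -> p.1 = q.1 ->
    word_val (p :: w) = word_val (q :: v) ->
  map letter_val (p :: w) = map letter_val (q :: v).
Proof.
elim: w v p q => [|p' w IH] v [z a] [z' b] rw rv ow ov /= zz' val_eq; subst z'.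
all: have vab : letter_val (z, a) = letter_val (z, b)
  by apply/eq_zexpg; rewrite -(N_red_cons rw) val_eq (N_red_cons rv).
all: rewrite vab; congr (_ :: _).
all: have rv' := red_word_catr (u := [:: (z, b)]) rv.
all: have rw' := red_word_catr (u := [:: (z, a)]) rw.
all: move: (val_eq); rewrite !word_val_cons vab => /mulgI val_eq'.
  by rewrite (red_nil rv') // -val_eq' word_val_nil.
case: v rv ov val_eq rv' val_eq' => [|q' v] rv ov val_eq rv' val_eq'.
  by have := red_nil rw'; rewrite word_val_cons val_eq' word_val_nil => /(_ erefl).
have zp' : p'.1 <> z by apply/nesym/(red_adjacent (u := [::]) rw).
have zq' : z <> q'.1 by apply: (red_adjacent (u := [::]) rv).
apply: IH => //; [by case/andP: ow|by case/andP: ov| |by rewrite word_val_cons].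
apply: (@over_third x y p' (z, b) q') => //.
by case/and3P: ow => _ op' _; case/and3P: ov => oz oq' _; apply/and4P.
Qed.

(** Exchange brings x to the front of the word starting with y and deletes its last letter; by
    uniqueness the result is the word starting with x. *)
Lemma red_over_shift x y a b w v : x <> y ->
    red_word ((x, a) :: w) -> red_word ((y, b) :: v) ->
    over x y ((x, a) :: w) -> over x y ((y, b) :: v) ->
    word_val ((x, a) :: w) = word_val ((y, b) :: v) ->
  0 < size w /\ exists s, map letter_val ((y, b) :: v) = rcons (map letter_val w) s.
Proof.
move=> xy rw rv ow ov wv.
have [/good_cons[[/= Xx _] _] _] := rw.
have := nz_red_cons rw; rewrite wv => /(nz_red_word Xx rv).
move=> [c [[|l u] [p [r [v_eq up ru val_u]]]]].
  (* The deleted letter is not the first one, whose generator is y. *)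
  by case: xy; move: up; rewrite word_val_nil conjg1; case: v_eq => <-.
(* Deleting an interior letter would make its two neighbours adjacent, and these have the same
   generator. *)
have r0 : r = [::].
  case: r v_eq ru {val_u} => // q r v_eq ru.
  rewrite (lastI l u) in v_eq ru; rewrite v_eq in rv ov.
  have rv' := rv; rewrite -cats1 -!catA in rv'.
  have rv'' := rv; rewrite cat_rcons in rv''.
  case: (red_adjacent (u := (x, c) :: belast l u) (p := last l u) (q := q) (v := r)).
    by rewrite cat_rcons in ru.
  apply: (@over_third x y (last l u) p q).
  - by move: ov; rewrite /over cat_rcons !all_cat /= => /and5P[_ -> -> ->].
  - exact: red_adjacent rv''.
  - by rewrite catA in rv'; apply: red_adjacent rv'.
rewrite {}r0 cats0 in v_eq ru val_u.
have : map letter_val ((x, a) :: w) = map letter_val ((x, c) :: l :: u).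
  apply: red_over_uniq rw ru ow _ _ _ => //=; last by rewrite wv.
  by move: ov; rewrite v_eq /over all_cat /= eqxx => /andP[].
move=> /= [_ w_eq]; rewrite -(size_map letter_val) w_eq; split=> //.
by exists (letter_val p); move: (congr1 (map letter_val) v_eq) => /= ->;
  rewrite map_cat /= -cats1.
Qed.

Lemma red_over_alternating x y w : mg_gens x -> mg_gens y -> x <> y ->
    red_word w -> over x y w -> nz (word_val w) x -> nz (word_val w) y ->
  exists a b, let p := (x, a) in let q := (y, b) in
    [/\ 1 < size w, good_letter p, good_letter q,
      word_val (alternating (size w) p q) = word_val w
    & word_val (alternating (size w) q p) = word_val w].
Proof.
move=> Xx Xy xy rw ow nzx nzy.
have ex z : mg_gens z -> (z == x) || (z == y) -> nz (word_val w) z ->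
    exists c v, [/\ red_word ((z, c) :: v), over x y ((z, c) :: v),
      word_val ((z, c) :: v) = word_val w & (size v).+1 = size w].
  move=> Xz zxy /(nz_red_word Xz rw)[c [u [p [v [w_eq _ ru val_u]]]]].
  exists c, (u ++ v); split=> //; last by rewrite w_eq !size_cat addnS.
  move: ow; rewrite w_eq /over /= zxy !all_cat /=.
  by case/and3P=> -> _ ->.
have xxy : (x == x) || (x == y) by rewrite eqxx.
have yxy : (y == x) || (y == y) by rewrite eqxx orbT.
have [a [v [rv ov val_v sz_v]]] := ex x Xx xxy nzx.
have [b [u [ru ou val_u sz_u]]] := ex y Xy yxy nzy.
have vu : word_val ((x, a) :: v) = word_val ((y, b) :: u) by rewrite val_v.
have [v_gt0 [s us]] := red_over_shift xy rv ru ov ou vu.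
rewrite over_sym in ou; rewrite over_sym in ov.
have [_ [t vt]] := red_over_shift (nesym xy) ru rv ou ov (esym vu).
have [valt ualt] := mutual_shift_alternating vt us.
exists a, b => /=; rewrite size_map sz_v in valt ualt.
split; rewrite -?sz_v //.
- by have [/good_cons[]] := rv.
- by have [/good_cons[]] := ru.
- by rewrite sz_v /word_val map_alternating -valt.
by rewrite sz_v /word_val map_alternating -ualt.
Qed.

(** The two words differ by a single type II operation on their alternating prefixes. *)
Definition braid_form x y g : Prop := exists a b k v,
  let p := (x, a) in let q := (y, b) in
  [/\ 1 < k, word_val (alternating k p q) = word_val (alternating k q p),
    red_word (alternating k p q ++ v), red_word (alternating k q p ++ v)
  & word_val (alternating k p q ++ v) = g].

Lemma braid_form_prefix x y u v : mg_gens x -> mg_gens y -> x <> y ->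
    red_word (u ++ v) -> over x y u -> nz (word_val u) x -> nz (word_val u) y ->
  braid_form x y (word_val (u ++ v)).
Proof.
move=> Xx Xy xy ruv ou ux uy; have [/good_cat[gu gv] _] := ruv.
have [a [b [u_gt1 ga gb val_x val_y]]] :=
  red_over_alternating Xx Xy xy (red_word_catl ruv) ou ux uy.
have red_alt p q : good_letter p -> good_letter q ->
    word_val (alternating (size u) p q) = word_val u ->
    red_word (alternating (size u) p q ++ v).
  move=> gp gq val_u; apply: red_word_eq ruv _ _ _.
  - by apply/good_cat; split=> //; apply: all_alternating.
  - by rewrite !word_val_cat val_u.
  by rewrite !size_cat size_alternating.
exists a, b, (size u), v => /=; rewrite val_x val_y.
by split; rewrite ?word_val_cat ?val_x //; apply: red_alt.
Qed.

(** Induction on the part v after a prefix u over {x, y}: while u lacks one of the two descents, a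
    letter can be moved from v to the front of u. *)
Lemma two_descents x y w : mg_gens x -> mg_gens y -> x <> y ->
    red_word w -> nz (word_val w) x -> nz (word_val w) y ->
  braid_form x y (word_val w).
Proof.
move=> Xx Xy xy.
have xxy : (x == x) || (x == y) by rewrite eqxx.
have yxy : (y == x) || (y == y) by rewrite eqxx orbT.
suff H n u v : size v <= n -> red_word (u ++ v) -> over x y u ->
    nz (word_val (u ++ v)) x -> nz (word_val (u ++ v)) y ->
  braid_form x y (word_val (u ++ v)).
  by move=> rw; exact: (H (size w) [::] w (leqnn _) rw isT).
elim: n u v => [|n IH] u v le_n ruv ou nzx nzy.
  have v0 : v = [::] by apply/nilP; rewrite /nilp -leqn0.
  by apply: braid_form_prefix => //; [move: nzx | move: nzy]; rewrite v0 cats0.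
have [/andP[ux uy]|] := boolP (nz (word_val u) x && nz (word_val u) y).
  exact: braid_form_prefix.
have [gu gv] := (good_cat _ _).1 (ruv.1).
suff step z : mg_gens z -> (z == x) || (z == y) -> nz (word_val (u ++ v)) z ->
    ~~ nz (word_val u) z -> exists c v', let u' := (z, c) :: u in
    [/\ size v' <= n, red_word (u' ++ v'), over x y u'
      & word_val (u' ++ v') = word_val (u ++ v)].
  rewrite negb_and => /orP[ux|uy].
    have [c [v' [le_v' r' o' val']]] := step x Xx xxy nzx ux.
    by rewrite -val' in nzx nzy *; apply: IH.
  have [c [v' [le_v' r' o' val']]] := step y Xy yxy nzy uy.
  by rewrite -val' in nzx nzy *; apply: IH.
(* As z is not a descent of u, the coordinate of v at z ^ u is nonzero; exchange in v yields a power
   of z ^ u, which passes to the left of u as a power of z. *)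
move=> Xz zxy; rewrite word_val_cat => /nz_mul/orP[-> //|+ _].
move=> /(exchange gv)[v1 [p [v2 [v_eq _ zp val_v]]]].
have le_v : size (v1 ++ v2) < size v by rewrite v_eq !size_cat addnS.
have val_uv : word_val (((z, p.2) :: u) ++ v1 ++ v2) = word_val (u ++ v).
  rewrite !word_val_cat word_val_cons val_v -zexpgJ conjgE /letter_val /=.
  by rewrite word_val_cat !mulgA mulgV mul1g.
exists p.2, (v1 ++ v2); split=> //.
- by rewrite -ltnS (leq_trans le_v).
- apply: red_word_eq ruv _ val_uv _; last 
  by rewrite /= size_cat [size (u ++ v)]size_cat -addnS leq_add2l.
  apply/good_cons; split; first by split; rewrite // -(gorderJ z (word_val u)).
  apply/good_cat; split=> //.
  move: gv; rewrite v_eq => /good_cat[gv1 /good_cons[_ gv2]].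
  exact/good_cat.
- by rewrite /over /= zxy.
by rewrite val_uv word_val_cat.
Qed.

(** * Comparison with syllabic words and syllabic length *)

Lemma syllabicP (s : seq M) : syllabic s <->
  exists2 w, good_word w & map letter_val w = s.
Proof.
split=> [|[w gw <-] _ /mapP[p pw ->]]; last first.
  elim: w gw pw => //= q w IH /good_cons[[Xq oq] gw]; rewrite inE.
  case/predU1P=> [->|]; last exact: IH.
  by exists q.1; split=> //; exists q.2.
elim: s => [|s ss IH] sylls; first by exists [::] => //; apply: List.Forall_nil.
have [|w gw <-] := IH; first by move=> t tss; apply: sylls; rewrite inE tss orbT.
have [x [Xx [a [xa ->]]]] := sylls s (mem_head _ _).
by exists ((x, a) :: w) => //; apply/good_cons.
Qed.

Lemma syl_lengthE w : red_word w -> syl_length (word_val w) = size w.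
Proof.
move=> [gw wmin].
have Aw : exists s, [/\ syllabic s, wprod s = word_val w & size s = size w].
  exists (map letter_val w); rewrite size_map; split=> //.
  by apply/syllabicP; exists w.
have [[s [/syllabicP[v gv <-]]]] := leastP (A := [set l | exists s,
  [/\ syllabic s, wprod s = word_val w & size s = l]]%classic) Aw.
rewrite -/(syl_length _) size_map => val_v sz_v /(_ _ Aw) le_w.
by apply/eqP; rewrite eqn_leq le_w -sz_v wmin.
Qed.

Lemma reducedP w : good_word w -> reduced (map letter_val w) <-> red_word w.
Proof.
move=> gw; rewrite /reduced -/(word_val w) size_map.
split=> [sz_w|/syl_lengthE //]; split=> // v gv val_v.
rewrite sz_w.
have Av : exists s, [/\ syllabic s, wprod s = word_val w & size s = size v].
  exists (map letter_val v); rewrite size_map; split=> //.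
  by apply/syllabicP; exists v.
have [_] := leastP (A := [set l | exists s,
  [/\ syllabic s, wprod s = word_val w & size s = l]]%classic) Av.
by apply.
Qed.

(** * M-operations and Property D *)

Lemma M_op2_cons (s : M) (r1 r2 : seq M) :
  clos_refl_trans _ (@M_op2 M) r1 r2 ->
  clos_refl_trans _ (@M_op2 M) (s :: r1) (s :: r2).
Proof.
elim=> [_ _ [v1 v2 t1 t2 k *]|v|v1 v2 v3 _ IH1 _ IH2].
- by apply: rt_step; apply: (@M_op2_swap M (s :: v1)).
- exact: rt_refl.
exact: rt_trans IH1 IH2.
Qed.

Lemma M_op_cons (s : M) (r1 r2 : seq M) :
  clos_refl_trans _ (@M_op M) r1 r2 ->
  clos_refl_trans _ (@M_op M) (s :: r1) (s :: r2).
Proof.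
elim=> [_ _ [[v1 v2 t1 t2 *|v1 v2 t1 t2 *]|[v1 v2 t1 t2 k *]]|v|v1 v2 v3 _ IH1 _ IH2].
- by apply: rt_step; left; apply: (@M_op1_merge M (s :: v1)).
- by apply: rt_step; left; apply: (@M_op1_cancel M (s :: v1)).
- by apply: rt_step; right; apply: (@M_op2_swap M (s :: v1)).
- exact: rt_refl.
exact: rt_trans IH1 IH2.
Qed.

Lemma M_op2_M_op (r1 r2 : seq M) :
  clos_refl_trans _ (@M_op2 M) r1 r2 -> clos_refl_trans _ (@M_op M) r1 r2.
Proof.
elim=> [v1 v2 v12|v1|v1 v2 v3 _ + _]; last exact: rt_trans.
  by apply: rt_step; right.
exact: rt_refl.
Qed.

Lemma good_syllable p : good_letter p -> syllable (letter_val p).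
Proof. by move=> [Xp op]; exists p.1; split=> //; exists p.2. Qed.

(* The case of equal first letters is [same]; otherwise both first generators are
   descents and [two_descents] inserts two words, one type II operation apart,
   that share their first generators with [w] and [v]. *)
Lemma M_op2_connected w v : red_word w -> red_word v ->
  word_val w = word_val v ->
  clos_refl_trans _ (@M_op2 M) (map letter_val w) (map letter_val v).
Proof.
move: {2}(size w) (leqnn (size w)) => n.
elim: n w v => [|n IH] w v.
  rewrite leqn0 => /nilP -> _ rv val_v.
  by rewrite (red_nil rv) -?val_v ?word_val_nil //; apply: rt_refl.
case: w => [_ _ rv val_v|[x a] w].
  by rewrite (red_nil rv) -?val_v ?word_val_nil //; apply: rt_refl.
rewrite ltnS => le_w rw.
(* This bound lets [same] start from the braid word beginning with y, which is not the word of the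
   induction. *)
have sz v' : red_word v' -> word_val ((x, a) :: w) = word_val v' ->
    size v' <= n.+1.
  move=> [_ vmin] val_v; apply: (@leq_trans (size w).+1) => //.
  exact: vmin rw.1 val_v.
have same z b c u u' : red_word ((z, b) :: u) -> red_word ((z, c) :: u') ->
    size u <= n -> word_val ((z, b) :: u) = word_val ((z, c) :: u') ->
    clos_refl_trans _ (@M_op2 M) (map letter_val ((z, b) :: u))
       (map letter_val ((z, c) :: u')).
  move=> ru ru' le_u val_u /=.
  have vbc : letter_val (z, b) = letter_val (z, c).
    by apply/eq_zexpg; rewrite -(N_red_cons ru) val_u (N_red_cons ru').
  rewrite vbc; apply/M_op2_cons/IH => //.
  - exact: (@red_word_catr [:: (z, b)] _ ru).
  - exact: (@red_word_catr [:: (z, c)] _ ru').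
  by move: val_u; rewrite !word_val_cons vbc => /mulgI.
case: v => [_ val_w|[y b] v rv val_wv].
  by have := red_nil rw (etrans val_w word_val_nil).
have [yx|/eqP xy] := eqVneq y x; first by subst y; apply: same.
have [/good_cons[[/= Xx _] _] _] := rw.
have [/good_cons[[/= Xy _] _] _] := rv.
have nzy := nz_red_cons rv; rewrite -val_wv in nzy.
have [c [d [[|k] [u []]]]] //=
  := two_descents Xx Xy (nesym xy) rw (nz_red_cons rw) nzy.
set p := (x, c); set q := (y, d); rewrite ltnS => k_gt0 val_pq rpq rqp val_u.
have val_u' : word_val (q :: alternating k p q ++ u) = word_val ((x, a) :: w).
  rewrite -val_u -[q :: _]/(alternating k.+1 q p ++ u).
  by rewrite -[p :: _]/(alternating k.+1 p q ++ u) !word_val_cat -val_pq.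
apply: rt_trans (same _ _ _ _ _ rw rpq le_w (esym val_u)) _.
apply: (@rt_trans _ _ _ (map letter_val (q :: alternating k p q ++ u))).
  apply: rt_step; rewrite -[p :: _]/(alternating k.+1 p q ++ u).
  rewrite -[q :: _]/(alternating k.+1 q p ++ u) !map_cat !map_alternating.
  apply: (@M_op2_swap M [::] _ (letter_val p) (letter_val q) k.+1) => //.
  - by apply: good_syllable; have [/good_cons[]] := rpq.
  - by apply: good_syllable; have [/good_cons[]] := rqp.
  - by rewrite -!map_alternating.
  rewrite -map_alternating syl_lengthE ?size_alternating //.
  exact: (@red_word_catl _ u).
apply: same => //; last by rewrite val_u'.
by rewrite -ltnS; apply: (sz _ rqp).
Qed.

(** At the shortest suffix x^a w that is not reduced, x is a descent of the reduced word w. Type II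
    operations bring a power of x to the front of w, where a type I operation applies. *)
Lemma shorten w : good_word w -> ~ red_word w -> exists2 s,
  clos_refl_trans _ (@M_op M) (map letter_val w) s & size s < size w.
Proof.
elim: w => [|[x a] w IH] gw nrw; first by case: nrw.
have [gx gw'] := (good_cons _ _).1 gw.
have [rw|/(IH gw')[s ws lt_s]] := pselect (red_word w); last first.
  by exists (letter_val (x, a) :: s) => //; apply: M_op_cons.
have nzw : nz (word_val w) x 
  by apply: contra_notT nrw => /(red_cons gx rw).
have [Xx _] := gx.
have [c [u [p [v [w_eq _ ru val_u]]]]] := nz_red_word Xx rw nzw.
have sz_w : size w = (size (u ++ v)).+1 by rewrite w_eq !size_cat addnS.
have path : clos_refl_trans _ (@M_op M) (map letter_val ((x, a) :: w))
    [:: letter_val (x, a), letter_val (x, c) & map letter_val (u ++ v)].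
  exact/M_op_cons/M_op2_M_op/(M_op2_connected rw ru (esym val_u)).
have gc : good_letter (x, c) by have [/good_cons[]] := ru.
have acE : letter_val (x, a) * letter_val (x, c) = zexpg x (a + c)%R.
  by rewrite zexpgD.
have [ac|ac] := boolP (gorder x %| (a + c)%R)%Z.
  exists (map letter_val (u ++ v)); last by rewrite size_map /= sz_w ltnS leqnSn.
  apply: rt_trans path _; apply: rt_step; left.
  apply: (@M_op1_cancel M [::]); [exact: good_syllable|exact: good_syllable|].
  by rewrite acE; apply/gorder_dvdz.
exists (zexpg x (a + c)%R :: map letter_val (u ++ v)).
  apply: rt_trans path _; apply: rt_step; left; rewrite -acE.
  apply: (@M_op1_merge M [::]); [exact: good_syllable|exact: good_syllable| |].
    by rewrite acE; apply: (good_syllable (p := (x, (a + c)%R))).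
  by rewrite acE => /gorder_dvdz; rewrite (negPf ac).
by rewrite /= size_map sz_w.
Qed.

Lemma M_op_stable (s t : seq M) : clos_refl_trans _ (@M_op M) s t ->
  syllabic s -> syllabic t /\ wprod t = wprod s.
Proof.
elim=> {s t} [s t st|//|s t r _ IH1 _ IH2 /IH1[/IH2[? ->] ->] //].
have sylE (w1 w2 w3 : seq M) : syllabic (w1 ++ w2 ++ w3) <->
    [/\ syllabic w1, syllabic w2 & syllabic w3].
  split=> [H|[H1 H2 H3] r]; last by rewrite !mem_cat => /or3P[/H1|/H2|/H3].
  by split=> r rw; apply: H; rewrite !mem_cat rw ?orbT.
case: st => [[w1 w2 r r' ? ? ? _|w1 w2 r r' ? ? rr']|[w1 w2 r r' k sr sr' _ rr' _]].
- move=> /sylE[? _ ?]; split; first by apply/sylE; split=> // _ /[1!inE]/eqP->.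
  by rewrite /wprod !big_cat !big_cons !big_nil /= !mulg1.
- move=> /sylE[? _ ?]; split; first by apply/(sylE _ [::]); split.
  by rewrite /wprod !big_cat !big_cons !big_nil /= mulg1 rr' mul1g.
move=> /sylE[? _ ?]; split; last by rewrite /wprod !big_cat /= -!/(wprod _) rr'.
apply/sylE; split=> // {rr'}; elim: k r r' sr sr' => [|k IH] r r' sr sr' // z.
by rewrite inE => /predU1P[->|] //; apply: IH.
Qed.

Lemma derivation_property_D : property_D M.
Proof.
split=> [s /syllabicP[w gw <-]|]; last first.
  move=> _ _ /syllabicP[w gw <-] /syllabicP[v gv <-].
  by move=> /(reducedP gw) rw /(reducedP gv) rv; apply: M_op2_connected.
have syl_w : syllabic (map letter_val w) by apply/syllabicP; exists w.
split=> [red t wt|Mred].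
  have [/syllabicP[v gv <-] val_v] := M_op_stable wt syl_w.
  by rewrite !size_map; apply: (((reducedP gw).1 red).2 _ gv).
apply/reducedP => //; have [//|/(shorten gw)[t wt]] := pselect (red_word w).
by rewrite ltnNge -(size_map letter_val w) Mred.
Qed.

End Derivation.

(** * The derivation on a Dyer group *)

Section DyerDerivation.
Variables (V : Type) (Gamma : dyer_graph V).

Let D := dyer_system Gamma.
Let gen : V -> D := dyer_gen Gamma.

(* A derivation sends x^-1 to - x^-1 . e_x, which is - e_x as x fixes e_x. *)
Fixpoint word_deriv (w : gword V) (t : D) : int :=
  if w is (v, b) :: w' then
    ((-1) ^+ b * (t == gen v)%:Z
      + word_deriv w' (t ^ (if b then (gen v)^-1 else gen v))%g)%R
  else 0.

Let cls (w : gword V) : D := pres_class (dyer_rel Gamma) w.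

Lemma cls_nil : cls [::] = 1.
Proof. by rewrite /cls pres_classE /gword_eval big_nil. Qed.

Lemma cls_cons v b w :
  cls ((v, b) :: w) = (if b then (gen v)^-1 else gen v) * cls w.
Proof. by rewrite /cls !pres_classE /gword_eval big_cons. Qed.

Lemma cls_rel l r : dyer_rel Gamma l r -> cls l = cls r.
Proof.
by move=> /(pres_rel [::] [::]); rewrite /= !cats0 => /pres_classP.
Qed.

Lemma word_deriv_cat u w t :
  word_deriv (u ++ w) t = (word_deriv u t + word_deriv w (t ^ cls u)%g)%R.
Proof.
elim: u t => [|[v b] u IH] t /=.
  by rewrite add0r cls_nil conjg1.
by rewrite IH addrA cls_cons conjgM.
Qed.

(** This turns the braid relation between involutions into the Coxeter relation. Peeling off both
    first letters leaves u (v u)^m v = (u v)^(m+1). *)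
Lemma alternating_val_quot m u v : gen u * gen u = 1 -> gen v * gen v = 1 ->
  cls (alternating m (u, false) (v, false)) *
    (cls (alternating m (v, false) (u, false)))^-1 = (gen u * gen v) ^+ m.
Proof.
elim: m u v => [|m IH] u v uu vv; first by rewrite mulgV.
rewrite /= !cls_cons invgM (mulg1_eq vv) -mulgA (mulgA (cls (alternating _ _ _))) IH //.
by rewrite mulgA mulg_expgC expgSr -mulgA.
Qed.

(** The terms are the reflections (u v)^i u of the dihedral group. Removing the first letter u
    conjugates them: u (v u)^i v u = (u v)^(i+1) u. *)
Lemma word_deriv_alternating m u v t :
    gen u * gen u = 1 -> gen v * gen v = 1 ->
  word_deriv (alternating m (u, false) (v, false)) t =
    (\sum_(i < m) (t == ((gen u * gen v) ^+ i * gen u)%g)%:Z)%R.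
Proof.
move=> uu vv; elim: m u v t uu vv => [|m IH] u v t uu vv.
  by rewrite big_ord0.
rewrite /= expr0 mul1r big_ord_recl expg0 mul1g IH //; congr (_ + _)%R.
apply: eq_bigr => i _; congr (Posz (nat_of_bool _)).
rewrite conjg_eqC conjgE invgK (mulg1_eq uu); congr (t == _).
by rewrite [LHS]mulgA mulgA mulg_expgC expgSr -!mulgA.
Qed.

(** For label 2 the generators commute, so each fixes the basis vector of the other. For other
    labels they are involutions, and both words list the same m reflections in opposite orders. *)
Lemma word_deriv_braid u v t : dg_adj Gamma u v ->
  word_deriv (alternating (dg_m Gamma u v) (u, false) (v, false)) t =
  word_deriv (alternating (dg_m Gamma u v) (v, false) (u, false)) t.
Proof.
move=> uv; set m := dg_m Gamma u v.
have braid : cls (alternating m (u, false) (v, false)) =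
             cls (alternating m (v, false) (u, false)).
  exact/cls_rel/dyer_rel_braid.
have [m2|/eqP m2] := eqVneq m 2.
  rewrite m2 /= in braid *.
  have comm_uv : gen u * gen v = gen v * gen u.
    by move: braid; rewrite !cls_cons !cls_nil !mulg1.
  rewrite !expr0 !mul1r !addr0 addrC; congr (_ + _)%R.
    by rewrite conjg_eqC conjgE invgK mulgA comm_uv mulgK.
  by rewrite conjg_eqC conjgE invgK mulgA -comm_uv mulgK.
have [fu fv] := dg_m_neq2 uv m2.
have square w : dg_f Gamma w = Some 2 -> gen w * gen w = 1.
  by move=> fw; have := cls_rel (dyer_rel_order fw); rewrite /= !cls_cons !cls_nil !mulg1.
have [uu vv] := (square u fu, square v fv).
have rm : (gen u * gen v) ^+ m = 1.
  by rewrite -alternating_val_quot // braid mulgV.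
(* With r = x_u x_v and r^m = 1, one has (r^-1)^j x_v = r^(m-1-j) x_u. *)
rewrite !word_deriv_alternating // (reindex_inj rev_ord_inj) /=.
apply: eq_bigr => i _; congr (Posz (nat_of_bool (t == _))).
have -> : gen v * gen u = (gen u * gen v)^-1.
  by rewrite invgM (mulg1_eq uu) (mulg1_eq vv).
rewrite expVgn; apply: (mulgI ((gen u * gen v) ^+ i.+1)).
rewrite mulgA -expgnDr subnKC // rm mul1g.
by rewrite expgS mulgA mulgK -mulgA vv mulg1.
Qed.

(** By [ctx] it suffices to compare the two sides of each relation. Cancellations and braids give
    equal integers; the order relations are what makes the congruence necessary. *)
Lemma word_deriv_pres_eq u w t : pres_eq (dyer_rel Gamma) u w ->
  (word_deriv u t = word_deriv w t %[mod gorder t])%Z.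
Proof.
have ctx u1 u2 w1 w2 s :
    (forall s, (word_deriv w1 s = word_deriv w2 s %[mod gorder s])%Z) ->
    cls w1 = cls w2 ->
    (word_deriv (u1 ++ w1 ++ u2) s = word_deriv (u1 ++ w2 ++ u2) s %[mod gorder s])%Z.
  move=> w12 cls12; rewrite !word_deriv_cat cls12.
  apply/eqP; rewrite eqz_modDl eqz_modDr; apply/eqP.
  by rewrite -(gorderJ s (cls u1)).
move=> uw; elim: uw t => {u w}.
- by [].
- by move=> u w _ IH t; rewrite IH.
- by move=> u w z _ IH1 _ IH2 t; rewrite IH1.
- move=> u w v b t; apply: (ctx u w _ [::]) => [s|]; last first.
    by apply/pres_classP; have := pres_cancel (dyer_rel Gamma) [::] [::] v b.
  have vv : (s ^ (if b then (gen v)^-1 else gen v) == gen v) = (s == gen v).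
    rewrite conjg_eqC; congr (s == _); rewrite conjgE.
    by case: b; rewrite !invgK ?mulKg ?mulgV ?mulg1.
  by rewrite /= vv addr0 -mulrDl; case: b {vv}; rewrite ?addrN ?addNr mul0r.
move=> u w l r Rlr t; apply: ctx => [{t u w} s|]; last exact: cls_rel.
case: Rlr => [v n fv|v v' vv']; last by rewrite word_deriv_braid.
have vn : gen v ^+ n = 1.
  have := cls_rel (dyer_rel_order fv); rewrite cls_nil => <-; elim: (n) => //= k IH.
  by rewrite cls_cons -IH expgS.
have -> : word_deriv (nseq n (v, false)) s = (n%:Z * (s == gen v)%:Z)%R.
  elim: (n) s => [|k IH] s /=; first by rewrite mul0r.
  rewrite IH conjg_eqC conjgE mulgV mulg1 invgK expr0 mul1r.
  by rewrite -[k.+1]add1n PoszD mulrDl mul1r.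
(* At the generator the value is n, and x^n = 1 suffices: the order of x need only divide n. *)
have [->|] := eqVneq s (gen v); last by rewrite mulr0.
rewrite mulr1 mod0z; apply/dvdz_mod0P; rewrite dvdzE /=.
exact/gorder_dvdn.
Qed.

End DyerDerivation.

Theorem theorem2p2 (V : Type) (Gamma : dyer_graph V) :
  property_D (dyer_system Gamma).
Proof.
(* The value depends on the chosen representative of g only up to multiples of the order of t. *)
pose N (g t : dyer_system Gamma) := word_deriv (pres_repr g) t.
have NE w t : (N (pres_class _ w) t = word_deriv w t %[mod gorder t])%Z.
  exact/word_deriv_pres_eq/pres_repr_class.
apply: (@derivation_property_D _ N) => [g h t|_ t [v _ <-]].
  rewrite -[g in LHS]pres_reprK -[h in LHS]pres_reprK -pres_class_cat NE.
  by rewrite word_deriv_cat pres_reprK.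
by rewrite NE /= expr0 mul1r addr0.
Qed.
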